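(* Let $C\subset\mathbb{R}^2$ be a fixed compact convex set with nonempty interior, and for each $n$ let $\xi_n$ be a set of $n$ independent random points chosen uniformly from $C$. Then $\deg\xi_n\to+\infty$ in probability as $n\to\infty$; that is, for every $L>0$, $$\lim_{n\to\infty}\mathbb{P}(\deg\xi_n\ge L)=1.$$
   Context: A finite set $X\subset\mathbb{R}^2$ is in general position if no three of its points are collinear. For such $X$ and a triple $\{x_1,x_2,x_3\}$ of distinct points of $X$, the triangle $t=\mathrm{conv}\{x_1,x_2,x_3\}$ is called empty (in $X$) if $t\cap X=\{x_1,x_2,x_3\}$. For a pair $\{x,y\}$ of distinct points of $X$, its degree $\deg(x,y;X)$ is the number of points $z\in X\setminus\{x,y\}$ such that $\{x,y,z\}$ determines an empty triangle in $X$. Define $\deg X=\max\deg(x,y;X)$, the maximum being over all two-element subsets $\{x,y\}$ of $X$. The random set $\xi_n$ consists of $n$ independent points each uniformly distributed in $C$ (normalized Lebesgue measure); it has $n$ points and is in general position with probability one, so $\deg\xi_n$ is almost surely well defined for $n\ge 2$. *)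

(* Defs.v *)
From HB Require Import structures.
From mathcomp Require Import all_boot all_order all_algebra finmap.
From mathcomp Require Import all_classical all_reals all_analysis.

Set Implicit Arguments.
Unset Strict Implicit.
Unset Printing Implicit Defensive.

Import Order.TTheory GRing.Theory Num.Theory.
Import numFieldNormedType.Exports.

Local Open Scope classical_set_scope.
Local Open Scope ring_scope.

(* [R^o * R^o] and [R * R] are convertible; the former carries the real vector
   space structure, the latter the product sigma-algebra and topology. *)
Definition conv_hull (R : realType) (A : set (R * R)) : set (R * R) :=
  smallest (@convex_set R (R^o * R^o)%type) A.

Definition empty_triangle (R : realType) (X : {fset R * R}) (x y z : R * R)
    : Prop :=
  conv_hull [set x; y; z] `&` [set` X] = [set x; y; z].

Definition pair_degree (R : realType) (X : {fset R * R}) (x y : R * R) : nat :=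
  #|` [fset z in X | [&& z != x, z != y & `[< empty_triangle X x y z >]]]%fset|.

(* The maximum over the empty range is 0: this is the value when X has at most
   one point.  Points in general position are not required: on a non-generic X
   (a null event for random points) the same formula is used. *)
Definition degree (R : realType) (X : {fset R * R}) : nat :=
  \max_(x <- X) \max_(y <- X | y != x) pair_degree X x y.

Definition area (R : realType) : set (R * R) -> \bar R :=
  (@lebesgue_measure R \x @lebesgue_measure R)%E.

Definition uniform_on (R : realType) (C : set (R * R)) (d : measure_display)
    (T : measurableType d) (P : probability T R) (X : {RV P >-> (R * R)%type})
    : Prop :=
  forall A : set (R * R), measurable A ->
    distribution P X A = (area (A `&` C) * ((fine (area C))^-1)%:E)%E.

Definition mutually_independent (R : realType) (d d' : measure_display)
    (T : measurableType d) (T' : measurableType d') (P : probability T R)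
    (I : finType) (X : I -> {RV P >-> T'}) : Prop :=
  forall (J : {set I}) (A : I -> set T'), (forall i, measurable (A i)) ->
    P (\bigcap_(i in [set` J]) (X i @^-1` A i)) =
      (\prod_(i in J) P (X i @^-1` A i))%E.

Definition point_set (R : realType) (d : measure_display)
    (T : measurableType d) (P : probability T R) (n : nat)
    (X : 'I_n -> {RV P >-> (R * R)%type}) (w : T) : {fset R * R} :=
  [fset X i w | i in 'I_n]%fset.

(* Main.v *)
Require Import Defs.
From HB Require Import structures.
From mathcomp Require Import all_boot all_order all_algebra finmap.
From mathcomp Require Import all_classical all_reals all_analysis.
From mathcomp Require Import measurable_realfun zify ring lra.

Set Implicit Arguments.
Unset Strict Implicit.
Unset Printing Implicit Defensive.

Import Order.TTheory GRing.Theory Num.Theory.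
Import numFieldNormedType.Exports.

Local Open Scope classical_set_scope.
Local Open Scope ring_scope.

(** At scale [n^(-1/2)] a uniform sample looks like a Poisson process of constant
    intensity, so a prescribed local configuration of finitely many points,
    given with some room around each point, appears somewhere in [C] with
    probability tending to 1.  It is enough to find a configuration which forces
    a pair of degree at least [L].

    The configuration.  Put [m = l + 2] and cut a square cell into [m * m] small
    squares.  Ask for one sample point in each column: in the columns 0 and 1 it
    lies in the bottom row, and in the columns [j >= 2] it lies in row [m - j],
    so that these [l] points form a descending staircase.  The triangle spanned
    by the two bottom points and the stair point of column [j] contains no other
    stair point: the later ones are beyond a vertical line, the earlier ones are
    above a horizontal line.  If the cell contains no further sample point, then
    all these triangles are empty, because the cell is convex; hence the two
    bottom points have degree at least [l] ([degree_staircase]).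

    Its occurrence.  Take [K] disjoint cells, side by side in a square contained
    in [C], each of probability [q = 1 / (2 n)].  Let [N] be the number of pairs
    formed by a cell and an injective assignment of sample points to the columns
    which realizes the configuration there.  By independence the mean of [N] is
    at least [K * c], where [c > 0] depends on [m] only ([many_patterns]).  Two
    assignments in one cell exclude each other, and in different cells they are
    independent up to the factor [(1 - q)^(- 2 m)], which tends to 1
    ([probability_two_patterns], [weak_dependence]).  The second moment method
    ([second_moment]) bounds the probability of [N = 0] by
    [1 / (K * c) + ((1 - q)^(- 2 m) - 1)].  Let [n] tend to infinity, with [K]
    arbitrarily large.

    Measurability.  A probability is controlled on measurable sets only, so the
    event [L <= degree] has to be shown measurable.  It is a finite Boolean
    combination of events that a sample point lies in the triangle of three
    others, and [conv_hullP] describes membership in a possibly degenerate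
    triangle by signs of polynomials. *)

(** * Membership in a triangle as a sign condition *)

Section Triangles.
Variable R : realType.
Implicit Types (A : set (R * R)) (p q x y z u v w : R * R) (a b c t : R).

Lemma convex_planeP A :
  @convex_set R (R^o * R^o)%type A <->
  forall p q t, 0 <= t <= 1 -> A p -> A q ->
    A (t * p.1 + (1 - t) * q.1, t * p.2 + (1 - t) * q.2).
Proof.
split => [cA p q t /andP[t0 t1] Ap Aq|cA p q l].
  have := cA p q (Itv01 t0 t1).
  by rewrite !inE => /(_ Ap Aq).
rewrite !inE => Ap Aq.
have l01 : 0 <= l%:num <= 1 by rewrite ge0 le1.
exact: (cA p q _ l01 Ap Aq).
Qed.

Definition barycentric x y z : set (R * R) :=
  [set p | exists a b c, [/\ 0 <= a, 0 <= b, 0 <= c, a + b + c = 1 &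
     p = (a * x.1 + b * y.1 + c * z.1, a * x.2 + b * y.2 + c * z.2)]].

(** Convex combinations of three points form a convex set.  Conversely such a
    combination is reached by two successive binary ones, unless the first two
    weights vanish and there is nothing to normalize. *)
Lemma conv_hull_barycentric x y z :
  conv_hull [set x; y; z] = barycentric x y z.
Proof.
apply/seteqP; split => [p|_ [a [b [c [a0 b0 c0 abc ->]]]]].
  move=> /(_ (barycentric x y z)); apply; split.
    apply/convex_planeP => _ _ t /andP[t0 t1]
      [a [b [c [a0 b0 c0 abc ->]]]] [a' [b' [c' [a'0 b'0 c'0 abc' ->]]]].
    exists (t * a + (1 - t) * a'), (t * b + (1 - t) * b'),
      (t * c + (1 - t) * c').
    have t1' : 0 <= 1 - t by rewrite subr_ge0.
    split; [exact: addr_ge0 (mulr_ge0 _ _) (mulr_ge0 _ _) ..| |] => //=.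
      transitivity (t * (a + b + c) + (1 - t) * (a' + b' + c')); first by ring.
      by rewrite abc abc'; ring.
    by congr (_, _); ring.
  move=> q [[|]->|->].
  - exists 1, 0, 0; split; rewrite ?ler01//; first by ring.
    by rewrite [LHS]surjective_pairing; congr (_, _); ring.
  - exists 0, 1, 0; split; rewrite ?ler01//; first by ring.
    by rewrite [LHS]surjective_pairing; congr (_, _); ring.
  - exists 0, 0, 1; split; rewrite ?ler01//; first by ring.
    by rewrite [LHS]surjective_pairing; congr (_, _); ring.
move=> B [/convex_planeP cB xyzB].
have [Bx By Bz] : [/\ B x, B y & B z].
  by split; apply: xyzB; [left; left|left; right|right].
have [ab0|ab0] := eqVneq (a + b) 0.
  have [a_0 b_0 c_1] : [/\ a = 0, b = 0 & c = 1] by split; lra.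
  by rewrite a_0 b_0 c_1 !mul0r !mul1r !add0r -surjective_pairing.
have s0 : 0 < a + b by rewrite lt_neqAle eq_sym ab0 addr_ge0.
have t01 : 0 <= a / (a + b) <= 1.
  by rewrite divr_ge0 ?(ltW s0)//= ler_pdivrMr// mul1r lerDl.
have s01 : 0 <= a + b <= 1 by lra.
have := cB _ z _ s01 (cB x y _ t01 Bx By) Bz => /=.
have -> : c = 1 - (a + b) by lra.
congr (B (_, _)); field.
all: exact: ab0.
Qed.

Definition cross u v : R := u.1 * v.2 - u.2 * v.1.
Definition dot u v : R := u.1 * v.1 + u.2 * v.2.

(** The identity [d1 *: u + d2 *: v + d3 *: w = 0] always holds for the three
    cross products below, so up to scaling they are the barycentric coordinates
    of the origin unless they all vanish.  If they vanish, the three vectors lie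
    on one line through the origin, and the origin is in their hull unless they
    are nonzero and on the same side of it. *)
Definition around_origin u v w : Prop :=
  let d1 := cross v w in let d2 := cross w u in let d3 := cross u v in
  [/\ d1 = 0, d2 = 0 & d3 = 0] /\
    [\/ dot u v <= 0, dot v w <= 0 | dot w u <= 0]
  \/ ~ [/\ d1 = 0, d2 = 0 & d3 = 0] /\
    ([/\ 0 <= d1, 0 <= d2 & 0 <= d3] \/ [/\ d1 <= 0, d2 <= 0 & d3 <= 0]).

(** For parallel [u] and [v] the vector [dot v v *: u - dot u v *: v] vanishes,
    and these coefficients are nonnegative when [dot u v <= 0]. *)
Lemma parallel_segment u v : cross u v = 0 -> dot u v <= 0 ->
  exists a b, [/\ 0 <= a, 0 <= b, a + b = 1,
    a * u.1 + b * v.1 = 0 & a * u.2 + b * v.2 = 0].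
Proof.
move=> uv0 uvneg; have [v0|v0] := eqVneq (dot v v) 0.
  exists 0, 1; move: v0; rewrite /dot => /eqP.
  rewrite paddr_eq0 -?expr2 ?sqr_ge0// !sqrf_eq0 => /andP[/eqP -> /eqP ->].
  by split; rewrite ?ler01//; ring.
have vv : 0 <= dot v v by rewrite /dot -!expr2 addr_ge0 ?sqr_ge0.
have s0 : 0 < dot v v - dot u v by lra.
exists (dot v v / (dot v v - dot u v)), (- dot u v / (dot v v - dot u v)).
split; rewrite ?divr_ge0 ?(ltW s0)//; first by lra.
- by field; rewrite gt_eqF.
- rewrite mulrAC (mulrAC _ _ v.1) -mulrDl.
  suff -> : dot v v * u.1 + - dot u v * v.1 = cross u v * v.2.
    by rewrite uv0 !mul0r.
  by rewrite /dot /cross; ring.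
- rewrite mulrAC (mulrAC _ _ v.2) -mulrDl.
  suff -> : dot v v * u.2 + - dot u v * v.2 = - cross u v * v.1.
    by rewrite uv0 oppr0 !mul0r.
  by rewrite /dot /cross; ring.
Qed.

(** If [a], [b], [c] are barycentric coordinates of the origin, taking the cross
    product of [a *: u + b *: v + c *: w = 0] with each vector shows that
    [(d1, d2, d3)] is [d1 + d2 + d3] times [(a, b, c)]; in the parallel case the
    products with [dot] show that three positive scalar products are
    impossible. *)
Lemma barycentric_origin u v w : barycentric u v w (0, 0) <-> around_origin u v w.
Proof.
split=> [[a [b [c [a0 b0 c0 abc []]]]] e1 e2|].
  have h1 : a * cross w u = b * cross v w.
    have : (a * u.1 + b * v.1 + c * w.1) * w.2 -
           (a * u.2 + b * v.2 + c * w.2) * w.1 = 0 by rewrite -e1 -e2; ring.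
    by rewrite /cross; lra.
  have h2 : b * cross u v = c * cross w u.
    have : (a * u.1 + b * v.1 + c * w.1) * u.2 -
           (a * u.2 + b * v.2 + c * w.2) * u.1 = 0 by rewrite -e1 -e2; ring.
    by rewrite /cross; lra.
  have h3 : c * cross v w = a * cross u v.
    have : (a * u.1 + b * v.1 + c * w.1) * v.2 -
           (a * u.2 + b * v.2 + c * w.2) * v.1 = 0 by rewrite -e1 -e2; ring.
    by rewrite /cross; lra.
  rewrite /around_origin; set d1 := cross v w in h1 h3 *.
  set d2 := cross w u in h1 h2 *; set d3 := cross u v in h2 h3 *.
  have [d0|d0] := pselect [/\ d1 = 0, d2 = 0 & d3 = 0]; [left|right]; split=> //.
    have [uv|uv] := leP (dot u v) 0; first exact: Or31.
    have [vw|vw] := leP (dot v w) 0; first exact: Or32.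
    have [wu|wu] := leP (dot w u) 0; first exact: Or33.
    exfalso.
    have eu : a * dot u u + b * dot u v + c * dot w u = 0.
      transitivity ((a * u.1 + b * v.1 + c * w.1) * u.1 +
           (a * u.2 + b * v.2 + c * w.2) * u.2); first by rewrite /dot; ring.
      by rewrite -e1 -e2; ring.
    have ev : a * dot u v + b * dot v v + c * dot v w = 0.
      transitivity ((a * u.1 + b * v.1 + c * w.1) * v.1 +
           (a * u.2 + b * v.2 + c * w.2) * v.2); first by rewrite /dot; ring.
      by rewrite -e1 -e2; ring.
    have uu : 0 <= dot u u by rewrite /dot -!expr2 addr_ge0 ?sqr_ge0.
    have vv : 0 <= dot v v by rewrite /dot -!expr2 addr_ge0 ?sqr_ge0.
    have auu := mulr_ge0 a0 uu; have auv := mulr_ge0 a0 (ltW uv).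
    have buv := mulr_ge0 b0 (ltW uv); have bvv := mulr_ge0 b0 vv.
    have cvw := mulr_ge0 c0 (ltW vw); have cwu := mulr_ge0 c0 (ltW wu).
    have /eqP : a * dot u v = 0 by lra.
    have /eqP : b * dot u v = 0 by lra.
    have /eqP : c * dot v w = 0 by lra.
    by rewrite !mulf_eq0 !(gt_eqF uv) (gt_eqF vw) !orbF
      => /eqP c_0 /eqP b_0 /eqP a_0; lra.
  have f1 : d1 = a * (d1 + d2 + d3) by rewrite -[LHS]mulr1 -abc; lra.
  have f2 : d2 = b * (d1 + d2 + d3) by rewrite -[LHS]mulr1 -abc; lra.
  have f3 : d3 = c * (d1 + d2 + d3) by rewrite -[LHS]mulr1 -abc; lra.
  have [s0|s0] := leP 0 (d1 + d2 + d3); [left|right].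
    by split; [rewrite f1|rewrite f2|rewrite f3]; exact: mulr_ge0.
  by split; [rewrite f1|rewrite f2|rewrite f3];
    apply: mulr_ge0_le0 => //; exact: ltW.
case=> [[[vw0 wu0 uv0]]|[dn0 sgn]].
  case=> [uv|vw|wu].
  - have [a [b [a0 b0 ab1 e1 e2]]] := parallel_segment uv0 uv.
    exists a, b, 0; split=> //; first by rewrite addr0.
    by rewrite !mul0r !addr0 e1 e2.
  - have [a [b [a0 b0 ab1 e1 e2]]] := parallel_segment vw0 vw.
    exists 0, a, b; split=> //; first by rewrite add0r.
    by rewrite !mul0r !add0r e1 e2.
  - have [a [b [a0 b0 ab1 e1 e2]]] := parallel_segment wu0 wu.
    exists b, 0, a; split=> //; first by lra.
    by congr (_, _); lra.
have key s : s = cross v w + cross w u + cross u v -> s != 0 ->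
    0 <= cross v w / s -> 0 <= cross w u / s -> 0 <= cross u v / s ->
    barycentric u v w (0, 0).
  move=> sE s0 a0 b0 c0.
  exists (cross v w / s), (cross w u / s), (cross u v / s); split=> //.
    by rewrite -!mulrDl -sE divff.
  by congr (_, _); rewrite /cross; ring.
case: sgn => -[d1 d2 d3].
- have s0 : 0 < cross v w + cross w u + cross u v.
    rewrite lt_neqAle; apply/andP; split; last by lra.
    by apply/eqP => s0; apply: dn0; split; lra.
  by apply: (key _ erefl); rewrite ?(gt_eqF s0)// divr_ge0// ltW.
- have s0 : cross v w + cross w u + cross u v < 0.
    rewrite lt_neqAle; apply/andP; split; last by lra.
    by apply/eqP => s0; apply: dn0; split; lra.
  by apply: (key _ erefl); rewrite ?(lt_eqF s0)// mulr_le0// invr_le0 ltW.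
Qed.

Lemma conv_hullP x y z p :
  conv_hull [set x; y; z] p <-> around_origin (x - p) (y - p) (z - p).
Proof.
rewrite conv_hull_barycentric -barycentric_origin; split.
  move=> [a [b [c [a0 b0 c0 abc ->]]]]; exists a, b, c; split=> //.
  have -> : c = 1 - a - b by lra.
  by congr (_, _) => /=; ring.
move=> [a [b [c [a0 b0 c0 abc [] /= e1 e2]]]]; exists a, b, c; split=> //.
rewrite [LHS]surjective_pairing; congr (_, _).
  by rewrite -[LHS]mul1r -abc; lra.
by rewrite -[LHS]mul1r -abc; lra.
Qed.

End Triangles.

(** * The degree of an indexed family of points *)

Section Degree.
Variable R : realType.
Implicit Types (Y : {fset R * R}) (x y z : R * R) (L : R).

Lemma degree_geP Y L : 0 < L -> L <= (degree Y)%:R <->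
  exists x y, [/\ x \in Y, y \in Y, y != x & L <= (pair_degree Y x y)%:R].
Proof.
move=> L0; split => [|[x [y [xY yY yx]]]]; last first.
  move=> /le_trans; apply; rewrite ler_nat /degree.
  apply: leq_trans (leq_bigmax_seq x xY isT).
  exact: (leq_bigmax_seq y yY yx).
rewrite /degree big_seq; elim/big_ind: _ => [|m1 m2 h1 h2|x xY].
- by rewrite leNgt L0.
- by rewrite /maxn; case: ifP.
rewrite big_seq_cond.
elim/big_ind: _ => [|m1 m2 h1 h2|y /andP[yY yx] le].
- by rewrite leNgt L0.
- by rewrite /maxn; case: ifP.
by exists x, y; split.
Qed.

(** Selects one index for every point counted by [pair_degree].  Sets of indices,
    unlike sets of points, range over a fixed finite type when the points are
    random, which turns the degree into a finite union of events. *)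
Lemma pair_degree_geP (I : finType) (f : I -> R * R) L x y :
  let Y := [fset f i | i in I]%fset in
  L <= (pair_degree Y x y)%:R <->
  exists K : {set I}, [/\ L <= #|K|%:R,
    forall k k', k \in K -> k' \in K -> f k = f k' -> k = k' &
    forall k, k \in K -> [/\ f k != x, f k != y & empty_triangle Y x y (f k)]].
Proof.
move=> Y; rewrite /pair_degree.
set F := [fset z in Y | _]%fset.
have FP z : (z \in F) = [&& z \in Y, z != x, z != y & `[< empty_triangle Y x y z >]].
  by rewrite !inE.
have card_im (K : {set I}) : {in K &, injective f} ->
    #|` [fset f i | i in K]%fset| = #|K|.
  by move=> finj; rewrite card_in_imfset// cardE.
split=> [LF|[K [LK Kinj Kgood]]]; last first.
  apply: le_trans LK _; rewrite ler_nat -card_im; last first.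
    by move=> k k' kK k'K; exact: Kinj.
  apply/fsubset_leq_card/fsubsetP => _ /imfsetP[k /= kK ->].
  rewrite FP; have [-> -> e] := Kgood k kK; rewrite asboolT// !andbT.
  exact: in_imfset.
(* For each point of [F] keep the index that [pick] returns for it. *)
pose K := [set i | (f i \in F) && ([pick i' | f i' == f i] == Some i)]%SET.
have KP i : (i \in K) = (f i \in F) && ([pick i' | f i' == f i] == Some i).
  by rewrite finset.in_set.
have Kinj : {in K &, injective f}.
  move=> k k' + + kk'; rewrite !KP kk' => /andP[_ /eqP ->] /andP[_ /eqP].
  by case.
exists K; split.
- suff -> : #|K| = #|` F| by [].
  rewrite -card_im//; congr #|` _|; apply/fsetP => z.
  apply/imfsetP/idP => [[k /= + ->]|zF]; first by rewrite KP => /andP[].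
  have : z \in Y by move: zF; rewrite FP => /andP[].
  move=> /imfsetP[i /= _ zi].
  have : [pick i' | f i' == z] != None.
    by case: pickP => // /(_ i); rewrite zi eqxx.
  case e : [pick i' | f i' == z] => [k|//] _.
  have kz : f k = z by move: e; case: pickP => // k' /eqP <- [->].
  by exists k => //=; rewrite KP kz zF e /=.
- by move=> k k' kK k'K; exact: Kinj.
- move=> k; rewrite KP => /andP[+ _]; rewrite FP.
  by move=> /and4P[_ -> -> /asboolP].
Qed.

Lemma empty_triangleP (I : finType) (f : I -> R * R) (i j k : I) :
  empty_triangle [fset f l | l in I]%fset (f i) (f j) (f k) <->
  forall l, conv_hull [set f i; f j; f k] (f l) ->
    [\/ f l = f i, f l = f j | f l = f k].
Proof.
rewrite /empty_triangle; split=> [e l lh|e].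
  have : [set f i; f j; f k] (f l).
    by rewrite -e; split=> //=; exact: in_imfset.
  by case=> [[|]|] h; [exact: Or31|exact: Or32|exact: Or33].
apply/seteqP; split=> [p [ph /imfsetP[l _ pl]]|p pijk].
  rewrite {p}pl in ph *; have [->|->|->] := e l ph; by [left; left|left; right|right].
split; first by move=> B [_ ]; exact.
by move: pijk => [[|]|] ->; exact: in_imfset.
Qed.

End Degree.

(** * Measurability of the degree *)

Section Measurability.
Variables (R : realType) (d : measure_display) (T : measurableType d).
Implicit Types (f g h : T -> R) (X Y Z W : T -> R * R).

Lemma measurable_finite_forall (I : finType) (Q : I -> T -> Prop) :
  (forall i, measurable [set w | Q i w]) ->
  measurable [set w | forall i, Q i w].
Proof.
move=> mQ; rewrite (_ : mkset _ = \bigcap_(i in [set: I]) [set w | Q i w]).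
  by apply: fin_bigcap_measurable.
by apply/seteqP; split => w /= h i => [_|]; exact: h.
Qed.

Lemma measurable_finite_exists (I : finType) (Q : I -> T -> Prop) :
  (forall i, measurable [set w | Q i w]) ->
  measurable [set w | exists i, Q i w].
Proof.
move=> mQ; rewrite (_ : mkset _ = \bigcup_(i in [set: I]) [set w | Q i w]).
  by apply: fin_bigcup_measurable.
by apply/seteqP; split => w /= [i]; exists i.
Qed.

Lemma measurable_imp (Q : Prop) (A : set T) :
  measurable A -> measurable [set w | Q -> A w].
Proof.
move=> mA; have [q|nq] := pselect Q.
  by rewrite (_ : mkset _ = A)//; apply/seteqP; split => w /=; [apply|].
by rewrite (_ : mkset _ = setT)//; apply/seteqP; split => w //= _ /nq.
Qed.

Lemma measurable_const (Q : Prop) : measurable [set _ : T | Q].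
Proof.
have [q|nq] := pselect Q.
  by rewrite (_ : mkset _ = setT)//; apply/seteqP; split.
by rewrite (_ : mkset _ = set0)//; apply/seteqP; split => w /=.
Qed.

Lemma measurable_le0 f : measurable_fun setT f -> measurable [set w | f w <= 0].
Proof.
move=> mf; rewrite (_ : mkset _ = setT `&` f @^-1` `]-oo, 0]); first exact: mf.
by apply/seteqP; split => w /=; rewrite in_itv//= => -[].
Qed.

Lemma measurable_eq0 f : measurable_fun setT f -> measurable [set w | f w = 0].
Proof.
move=> mf; rewrite (_ : mkset _ = setT `&` f @^-1` [set 0]); first exact: mf.
by apply/seteqP; split => w /=; [|case].
Qed.

Lemma measurable_cross X Y : measurable_fun setT X -> measurable_fun setT Y ->
  measurable_fun setT (fun w => cross (X w) (Y w)).
Proof.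
move=> /measurable_fun_pairP[mX1 mX2] /measurable_fun_pairP[mY1 mY2].
apply: measurable_funB; exact: measurable_funM.
Qed.

Lemma measurable_dot X Y : measurable_fun setT X -> measurable_fun setT Y ->
  measurable_fun setT (fun w => dot (X w) (Y w)).
Proof.
move=> /measurable_fun_pairP[mX1 mX2] /measurable_fun_pairP[mY1 mY2].
apply: measurable_funD; exact: measurable_funM.
Qed.

Lemma measurable_sub X Y : measurable_fun setT X -> measurable_fun setT Y ->
  measurable_fun setT (fun w => X w - Y w).
Proof.
move=> /measurable_fun_pairP[mX1 mX2] /measurable_fun_pairP[mY1 mY2].
apply/measurable_fun_pairP; split; exact: measurable_funB.
Qed.

Lemma measurable_around_origin X Y Z : measurable_fun setT X ->
  measurable_fun setT Y -> measurable_fun setT Z ->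
  measurable [set w | around_origin (X w) (Y w) (Z w)].
Proof.
move=> mX mY mZ; rewrite /around_origin.
pose D := [set w | cross (Y w) (Z w) = 0] `&` [set w | cross (Z w) (X w) = 0]
  `&` [set w | cross (X w) (Y w) = 0].
pose O := [set w | dot (X w) (Y w) <= 0] `|` [set w | dot (Y w) (Z w) <= 0]
  `|` [set w | dot (Z w) (X w) <= 0].
pose N := [set w | cross (Y w) (Z w) <= 0] `&` [set w | cross (Z w) (X w) <= 0]
  `&` [set w | cross (X w) (Y w) <= 0].
pose M := [set w | - cross (Y w) (Z w) <= 0]
  `&` [set w | - cross (Z w) (X w) <= 0] `&` [set w | - cross (X w) (Y w) <= 0].
rewrite (_ : mkset _ = (D `&` O) `|` (~` D `&` (M `|` N))); last first.
  apply/seteqP; rewrite /D /O /M /N; split => w /=; rewrite !oppr_le0.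
    move=> [[[h1 h2 h3] o]|[nd [[h1 h2 h3]|[h1 h2 h3]]]].
    - by left; split=> //; case: o => ?; [left; left|left; right|right].
    - by right; split=> [[[? ?] ?]|]; [exact: nd|by left].
    - by right; split=> [[[? ?] ?]|]; [exact: nd|by right].
  move=> [[[[h1 h2] h3] o]|[nd o]].
    left; split=> //; case: o => [[|]|] ?; by [exact: Or31|exact: Or32|exact: Or33].
  right; split=> [[h1 h2 h3]|]; first exact: nd.
  by case: o => [[[h1 h2] h3]|[[h1 h2] h3]]; [left|right].
have mD : measurable D.
  by apply: measurableI; [apply: measurableI|]; apply: measurable_eq0;
    exact: measurable_cross.
apply: measurableU; apply: measurableI => //.
- by apply: measurableU; [apply: measurableU|]; apply: measurable_le0;
    exact: measurable_dot.
- exact: measurableC.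
- apply: measurableU; (apply: measurableI; [apply: measurableI|]);
    apply: measurable_le0; try apply: measurable_funN; exact: measurable_cross.
Qed.

Lemma measurable_points_eq X Y : measurable_fun setT X ->
  measurable_fun setT Y -> measurable [set w | X w = Y w].
Proof.
move=> /measurable_fun_pairP[mX1 mX2] /measurable_fun_pairP[mY1 mY2].
rewrite (_ : mkset _ = [set w | (X w).1 - (Y w).1 = 0] `&`
                       [set w | (X w).2 - (Y w).2 = 0]).
  by apply: measurableI; apply: measurable_eq0; exact: measurable_funB.
apply/seteqP; split => w /= => [->|[/subr0_eq h1 /subr0_eq h2]].
  by rewrite !subrr.
by rewrite [LHS]surjective_pairing h1 h2 -surjective_pairing.
Qed.

Lemma measurable_points_neq X Y : measurable_fun setT X ->
  measurable_fun setT Y -> measurable [set w | X w != Y w].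
Proof.
move=> mX mY; rewrite (_ : mkset _ = ~` [set w | X w = Y w]).
  by apply: measurableC; exact: measurable_points_eq.
by apply/seteqP; split => w /= /eqP.
Qed.

Lemma measurable_empty_triangle (I : finType) (f : I -> T -> R * R) (i j k : I) :
  (forall l, measurable_fun setT (f l)) ->
  measurable [set w | empty_triangle [fset f l w | l in I]%fset
                        (f i w) (f j w) (f k w)].
Proof.
move=> mf.
pose S l := [set w | around_origin (f i w - f l w) (f j w - f l w) (f k w - f l w)].
pose E l i' := [set w | f l w = f i' w].
rewrite (_ : mkset _ = [set w | forall l, (~` S l `|` (E l i `|` E l j `|` E l k)) w]).
  apply: measurable_finite_forall => l; apply: measurableU.
    by apply/measurableC/measurable_around_origin; exact: measurable_sub.
  by apply: measurableU; [apply: measurableU|]; exact: measurable_points_eq.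
apply/seteqP; split => w /=.
  move=> /(empty_triangleP (f^~ w)) e l.
  have [Sl|] := pselect (S l w); [right|by left].
  by have /conv_hullP/e[] := Sl => ?; [left; left|left; right|right].
move=> e; apply/(empty_triangleP (f^~ w)) => l /conv_hullP h.
by have [//|[[|]|]] := e l => ?; [exact: Or31|exact: Or32|exact: Or33].
Qed.

(** A large degree is witnessed by two indices and a set of indices, hence by one
    of finitely many events. *)
Lemma measurable_degree_ge (P : probability T R) n
    (X : 'I_n -> {RV P >-> (R * R)%type}) (L : R) : 0 < L ->
  measurable [set w | L <= (degree (point_set X w))%:R].
Proof.
move=> L0; have mX i : measurable_fun setT (X i) by exact: measurable_funPT.
pose good (ij : 'I_n * 'I_n) (K : {set 'I_n}) : set T :=
  [set w | X ij.2 w != X ij.1 w] `&` [set w | L <= #|K|%:R] `&`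
  [set w | forall kk : 'I_n * 'I_n, kk.1 \in K -> kk.2 \in K -> kk.1 != kk.2 ->
             X kk.1 w != X kk.2 w] `&`
  [set w | forall k, k \in K ->
    ([set w | X k w != X ij.1 w] `&` [set w | X k w != X ij.2 w] `&`
     [set w | empty_triangle (point_set X w) (X ij.1 w) (X ij.2 w) (X k w)]) w].
rewrite (_ : mkset _ = [set w | exists ij, exists K, good ij K w]).
  apply: measurable_finite_exists => ij; apply: measurable_finite_exists => K.
  do 3?apply: measurableI.
  - exact: measurable_points_neq.
  - exact: measurable_const.
  - apply: measurable_finite_forall => kk; do 3 apply: measurable_imp.
    exact: measurable_points_neq.
  - apply: measurable_finite_forall => k; apply: measurable_imp.
    do 2?apply: measurableI; try exact: measurable_points_neq.
    exact: measurable_empty_triangle.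
apply/seteqP; split => w /=.
  move=> /(degree_geP _ L0)[_ [_ [/imfsetP[i _ ->] /imfsetP[j _ ->] ji]]].
  move=> /(pair_degree_geP (X^~ w))[K [LK Kinj Kgood]].
  exists (i, j), K; split; [split; [split|]|] => //=.
    move=> [k k'] /= kK k'K; apply: contra_neq; exact: Kinj.
  by move=> k /Kgood[].
move=> [[i j] [K [[[ji LK] Kinj] Kgood]]].
apply/(degree_geP _ L0); exists (X i w), (X j w); split=> //; try exact: in_imfset.
apply/(pair_degree_geP (X^~ w)); exists K; split=> //.
  by move=> k k' kK k'K; apply: contra_eq => kk'; exact: (Kinj (k, k')).
by move=> k /Kgood[[]].
Qed.

End Measurability.

(** * A staircase in a cell has large degree *)

Section Staircase.
Variable R : realType.
Implicit Types (a b c h t : R) (p q x y z : R * R).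

Lemma conv_hull_sub (B : set (R * R)) x y z :
  @convex_set R (R^o * R^o)%type B -> B x -> B y -> B z ->
  conv_hull [set x; y; z] `<=` B.
Proof. by move=> cB Bx By Bz p; apply; split=> // _ [[|]|] ->. Qed.

Definition square a b h : set (R * R) := `[a, a + h[ `*` `[b, b + h[.

Lemma squareP a b h p : square a b h p <->
  (a <= p.1 < a + h) /\ (b <= p.2 < b + h).
Proof. by rewrite /square /= !in_itv. Qed.

Lemma convex_combination_ge t c a b : 0 <= t <= 1 -> c <= a -> c <= b ->
  c <= t * a + (1 - t) * b.
Proof. by move=> /andP[t0 t1] ca cb; nra. Qed.

Lemma convex_combination_lt t c a b : 0 <= t <= 1 -> a < c -> b < c ->
  t * a + (1 - t) * b < c.
Proof.
move=> /andP[t0 t1] ac bc; have [->|tn0] := eqVneq t 0; first by lra.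
have tp : 0 < t by rewrite lt_neqAle eq_sym tn0.
by nra.
Qed.

Lemma convex_left_halfplane c :
  @convex_set R (R^o * R^o)%type [set p : R * R | p.1 < c].
Proof.
by apply/convex_planeP => p q t t01 /= pc qc; exact: convex_combination_lt.
Qed.

Lemma convex_lower_halfplane c :
  @convex_set R (R^o * R^o)%type [set p : R * R | p.2 < c].
Proof.
by apply/convex_planeP => p q t t01 /= pc qc; exact: convex_combination_lt.
Qed.

Lemma convex_square a b h : @convex_set R (R^o * R^o)%type (square a b h).
Proof.
apply/convex_planeP => p q t t01.
move=> /squareP[/andP[? ?] /andP[? ?]] /squareP[/andP[? ?] /andP[? ?]].
by apply/squareP; rewrite !convex_combination_ge ?convex_combination_lt.
Qed.

(** The row of the point in column [j]: the columns 0 and 1 hold the common edge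
    of the triangles, the others the descending staircase.  For
    [2 <= j < m] the row is positive, so that the staircase is above the edge. *)
Definition stair m j := (if j < 2 then 0 else m - j)%N.

Definition stair_square a b h m j : set (R * R) :=
  square (a + j%:R * h) (b + (stair m j)%:R * h) h.

(** Separates grid columns as well as grid rows; every disjointness argument
    below reduces to it. *)
Lemma next_column h i j : 0 <= h -> (i < j)%N -> i%:R * h + h <= j%:R * h.
Proof.
move=> h0 ij; rewrite -{2}(mul1r h) -mulrDl ler_wpM2r//.
by rewrite natr1 ler_nat.
Qed.

Lemma stair_lt m j : (j < m)%N -> (stair m j < m)%N.
Proof.
move=> jm; have m0 : (0 < m)%N by exact: leq_ltn_trans jm.
by rewrite /stair; case: (ltnP j 2) => // j2; rewrite ltn_subrL m0 andbT ltnW.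
Qed.

Lemma stair_square_sub a b h m j : 0 <= h -> (j < m)%N ->
  stair_square a b h m j `<=` square a b (m%:R * h).
Proof.
move=> h0 jm p /squareP[/andP[p1 p1'] /andP[p2 p2']]; apply/squareP.
have jh : 0 <= j%:R * h by rewrite mulr_ge0.
have sh : 0 <= (stair m j)%:R * h by rewrite mulr_ge0.
have := next_column h0 jm; have := next_column h0 (stair_lt jm).
by move=> ? ?; split; apply/andP; split; lra.
Qed.

Lemma stair_square_disjoint a b h m i j p : 0 <= h ->
  stair_square a b h m i p -> stair_square a b h m j p -> i = j.
Proof.
move=> h0 /squareP[/andP[pi pi'] _] /squareP[/andP[pj pj'] _].
case: (ltngtP i j) => // /(next_column h0) ?; exfalso; lra.
Qed.

(** The edge joins the points of the columns 0 and 1.  A sample point in the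
    triangle of this edge and the stair point of column [j] is in the cell, which
    is convex, so it is one of the selected points.  A later stair point is
    separated from the triangle by the right side of column [j], an earlier one
    by the top of row [m - j]. *)
Lemma degree_staircase a b h n l (f : 'I_n -> R * R) (s : 'I_l.+2 -> 'I_n) :
  0 <= h ->
  (forall j : 'I_l.+2, stair_square a b h l.+2 j (f (s j))) ->
  (forall i, i \notin codom s -> ~ square a b (l.+2%:R * h) (f i)) ->
  (l%:R : R) <= (degree [fset f i | i in 'I_n]%fset)%:R.
Proof.
move=> h0 fs fo; have [->|l0] := posnP l; first exact: ler0n.
have fs_inj i j : f (s i) = f (s j) -> i = j.
  move=> e; apply/val_inj/(stair_square_disjoint h0 (fs i)).
  by rewrite e; exact: fs.
pose i0 : 'I_l.+2 := ord0; pose i1 : 'I_l.+2 := Ordinal (isT : (1 < l.+2)%N).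
apply/degree_geP; first by rewrite ltr0n.
exists (f (s i0)), (f (s i1)); split; try exact: in_imfset.
  by apply/eqP => /fs_inj /(congr1 val).
apply/pair_degree_geP.
pose z (j : 'I_l) : 'I_l.+2 := lift ord0 (lift ord0 j).
have zinj : injective z by move=> j j' /lift_inj /lift_inj.
exists [set s (z j) | j in 'I_l]%SET; split.
- rewrite card_imset ?card_ord// => j j' e; apply/zinj/fs_inj; by rewrite e.
- by move=> _ _ /imsetP[j _ ->] /imsetP[j' _ ->] /fs_inj ->.
move=> _ /imsetP[j _ ->]; split.
- by apply/eqP => /fs_inj /(congr1 val).
- by apply/eqP => /fs_inj /(congr1 val).
apply/empty_triangleP => i ih.
have : square a b (l.+2%:R * h) (f i).
  move: ih; apply: conv_hull_sub; first exact: convex_square.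
  - exact: stair_square_sub (ltn_ord i0) _ (fs i0).
  - exact: stair_square_sub (ltn_ord i1) _ (fs i1).
  - exact: stair_square_sub (ltn_ord (z j)) _ (fs (z j)).
have [/codomP[k ik]|/fo//] := boolP (i \in codom s).
move=> _; rewrite {fo i}ik in ih *.
have [k0|k0] := eqVneq k i0; first by rewrite k0; exact: Or31.
have [k1|k1] := eqVneq k i1; first by rewrite k1; exact: Or32.
have k2 : (2 <= k)%N.
  by move: k0 k1; rewrite -!val_eqE /=; case: (val k) => [|[]].
have z2 : (2 <= z j)%N by [].
have z_lt := ltn_ord (z j).
have stair0 : (stair l.+2 0)%:R * h = 0 by rewrite mul0r.
have stair1 : (stair l.+2 1)%:R * h = 0 by rewrite mul0r.
have [/andP[_ x0] /andP[_ y0]] := (squareP _ _ _ _).1 (fs i0).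
have [/andP[_ x1] /andP[_ y1]] := (squareP _ _ _ _).1 (fs i1).
have [/andP[_ xz] /andP[_ yz]] := (squareP _ _ _ _).1 (fs (z j)).
have [/andP[xk _] /andP[yk _]] := (squareP _ _ _ _).1 (fs k).
rewrite [nat_of_ord i0]/= [nat_of_ord i1]/= in x0 y0 x1 y1.
rewrite stair0 in y0; rewrite stair1 in y1.
case: (ltngtP k (z j)) => [kz|zk|/val_inj kz]; [exfalso|exfalso|].
- have zj0 : 0 <= (stair l.+2 (z j))%:R * h by rewrite mulr_ge0.
  have kz_stair : (stair l.+2 (z j) < stair l.+2 k)%N.
    by rewrite /stair !ifN -?leqNgt // ltn_sub2l.
  have := next_column h0 kz_stair.
  have : (f (s k)).2 < b + (stair l.+2 (z j))%:R * h + h.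
    by apply: (conv_hull_sub (@convex_lower_halfplane _) _ _ _ ih) => //=; lra.
  lra.
- have zj0 := next_column h0 z2.
  have := next_column h0 zk.
  have : (f (s k)).1 < a + (z j)%:R * h + h.
    apply: (conv_hull_sub (@convex_left_halfplane _) _ _ _ ih) => //=; lra.
  lra.
- by rewrite kz; exact: Or33.
Qed.

End Staircase.

(** * The second moment method *)

Section SecondMoment.
Variables (R : realType) (d : measure_display) (T : measurableType d).
Variable P : probability T R.

(** Integrating the inequality between the two sums of indicators. *)
Lemma le_sum_probability (I J : finType) (A : I -> set T) (B : J -> set T)
    (a : I -> R) (b : J -> R) :
  (forall i, measurable (A i)) -> (forall j, measurable (B j)) ->
  (forall i, 0 <= a i) -> (forall j, 0 <= b j) ->
  (forall w, \sum_i a i * \1_(A i) w <= \sum_j b j * \1_(B j) w) ->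
  (\sum_i (a i)%:E * P (A i) <= \sum_j (b j)%:E * P (B j))%E.
Proof.
move=> mA mB a0 b0 ab.
have expectation (K : finType) (C : K -> set T) (c : K -> R) :
    (forall k, measurable (C k)) -> (forall k, 0 <= c k) ->
    (\sum_k (c k)%:E * P (C k) =
     \int[P]_w (\sum_k c k * \1_(C k) w)%:E)%E.
  move=> mC c0; under eq_integral do rewrite -sumEFin.
  rewrite ge0_integral_sum//; last first.
  - by move=> k w _; rewrite lee_fin mulr_ge0.
  - move=> k; apply/measurable_EFinP; apply: measurable_funM => //.
  apply: eq_bigr => k _; under eq_integral do rewrite EFinM.
  rewrite ge0_integralZl_EFin//; last exact/measurable_EFinP.
  by rewrite integral_indic// setIT.
rewrite !expectation//; apply: ge0_le_integral => //.
- by move=> w _; rewrite lee_fin sumr_ge0// => i _; rewrite mulr_ge0.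
- apply/measurable_EFinP; apply: measurable_sum => i.
  exact: measurable_funM.
- apply/measurable_EFinP; apply: measurable_sum => i.
  exact: measurable_funM.
- by move=> w _; rewrite lee_fin.
Qed.

(** Let [N] be the number of events that occur.  On their union
    [2 * t * N <= 1 + (t * N) ^+ 2], and [N = 0] off it; taking expectations
    with [t] the inverse of the mean of [N] gives the bound. *)
Lemma second_moment (I : finType) (A : I -> set T) (p rho : R) :
  (0 < #|I|)%N -> 0 < p -> 0 <= rho -> (forall i, measurable (A i)) ->
  (forall i, P (A i) = p%:E) ->
  (forall i j, i != j -> P (A i `&` A j) <= (rho * p ^+ 2)%:E)%E ->
  ((1 - ((#|I|%:R * p)^-1 + (rho - 1)))%:E <= P (\bigcup_i A i))%E.
Proof.
move=> I0 p0 rho0 mA PA PAA.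
set N : R := #|I|%:R; have N0 : 0 < N by rewrite ltr0n.
pose t := (N * p)^-1; have t0 : 0 < t by rewrite invr_gt0 mulr_gt0.
have mU : measurable (\bigcup_i A i) by apply: fin_bigcup_measurable.
(* The indicators of the union and of the products in the expansion of the
   square of [N]. *)
pose B (o : unit + I * I) : set T :=
  if o is inr ij then A ij.1 `&` A ij.2 else \bigcup_i A i.
pose b (o : unit + I * I) : R := if o is inr _ then t ^+ 2 else 1.
have : (\sum_i (2 * t)%:E * P (A i) <= \sum_o (b o)%:E * P (B o))%E.
  apply: le_sum_probability => //.
  - by case=> [_|ij] //; apply: measurableI.
  - by move=> i; rewrite mulr_ge0// ltW.
  - by case=> [_|ij] /=; rewrite ?ler01 ?sqr_ge0.
  move=> w; rewrite big_sumType /= big_const card_unit /= mul1r addr0.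
  rewrite -(pair_bigA _ (fun i j => t ^+ 2 * \1_(A i `&` A j) w)) /=.
  set s := \sum_i (\1_(A i) w : R).
  have -> : \sum_i \sum_j t ^+ 2 * \1_(A i `&` A j) w = (t * s) ^+ 2.
    rewrite exprMn (expr2 s) mulr_suml mulr_sumr; apply: eq_bigr => i _.
    rewrite mulr_sumr mulr_sumr; apply: eq_bigr => j _.
    by rewrite indicI.
  rewrite -mulr_sumr -/s.
  have [[i _ Aiw]|nA] := pselect ((\bigcup_i A i) w).
    rewrite indicE mem_set; last by exists i.
    by have := sqr_ge0 (t * s - 1); rewrite /=; lra.
  rewrite (_ : s = 0); first by rewrite !mulr0 expr0n addr0.
  by rewrite /s big1// => i _; rewrite indicE memNset// => Aiw; apply: nA; exists i.
have -> : (\sum_i (2 * t)%:E * P (A i) = 2%:E)%E.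
  under eq_bigr do rewrite PA -EFinM.
  rewrite sumEFin sumr_const -mulr_natr -/N; congr _%:E; rewrite /t.
  by field; rewrite !gt_eqF.
rewrite big_sumType /= big_const card_unit /= mul1e adde0.
rewrite -(pair_bigA _ (fun i j => (t ^+ 2)%:E * P (A i `&` A j)))%E /=.
have diag : (\sum_i \sum_j (t ^+ 2)%:E * P (A i `&` A j) <=
             (t ^+ 2 * (N * p + N ^+ 2 * (rho * p ^+ 2)))%:E)%E.
  have row i : (\sum_j (t ^+ 2)%:E * P (A i `&` A j) <=
      (t ^+ 2 * (p + N * (rho * p ^+ 2)))%:E)%E.
    rewrite (bigD1 i)//= setIid PA mulrDr EFinD.
    apply: leeD; first by rewrite -EFinM.
    apply: (@le_trans _ _ (\sum_(j | j != i) (t ^+ 2 * (rho * p ^+ 2))%:E)%E).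
      apply: lee_sum => j ji; rewrite (EFinM (t ^+ 2)) lee_wpmul2l ?lee_fin
        ?sqr_ge0//.
      by apply: PAA; rewrite eq_sym.
    rewrite sumEFin lee_fin sumr_const -[leLHS]mulr_natr -mulrA
      ler_wpM2l ?sqr_ge0//.
    rewrite [leLHS]mulrC; apply: ler_wpM2r; first by rewrite mulr_ge0 ?sqr_ge0.
    by rewrite /N ler_nat; exact: max_card.
  apply: (@le_trans _ _ (\sum_(i : I) (t ^+ 2 * (p + N * (rho * p ^+ 2)))%:E)%E).
    exact: lee_sum.
  rewrite sumEFin lee_fin sumr_const -mulr_natr -/N le_eqVlt; apply/orP; left.
  by apply/eqP; ring.
move=> /le_trans/(_ (leeD2l (P (\bigcup_i A i)) diag)).
rewrite addeC -leeBlDl// -EFinB; apply: le_trans; rewrite lee_fin.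
rewrite /t; set M := N * p; have M0 : 0 < M by exact: mulr_gt0.
have -> : M^-1 ^+ 2 * (M + N ^+ 2 * (rho * p ^+ 2)) = M^-1 + rho.
  by rewrite /M; field; rewrite !gt_eqF.
lra.
Qed.

End SecondMoment.

(** * Patterns in an independent sample *)

Section Patterns.
Variables (R : realType) (d d' : measure_display) (T : measurableType d).
Variables (T' : measurableType d') (P : probability T R) (n m : nat).
Variable X : 'I_n -> {RV P >-> T'}.
Implicit Types (U : 'I_m -> set T') (Q : set T') (s : {ffun 'I_m -> 'I_n}).

Definition slot U Q s (i : 'I_n) : set T' :=
  if [pick j | s j == i] is Some j then U j else ~` Q.

(** One constraint per sample point, including the points that are not assigned
    to a column, so that independence gives the probability as a product. *)
Definition pattern U Q s : set T := [set w | forall i, slot U Q s i (X i w)].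

Lemma slot_codom U Q s j : injective s -> slot U Q s (s j) = U j.
Proof.
move=> sI; rewrite /slot; case: pickP => [k /eqP/sI -> //|/(_ j)].
by rewrite eqxx.
Qed.

Lemma slot_notin U Q s i : i \notin codom s -> slot U Q s i = ~` Q.
Proof.
rewrite /slot; case: pickP => // k /eqP <-.
by rewrite codom_f.
Qed.

Lemma patternP U Q s w : injective s -> pattern U Q s w <->
  (forall j, U j (X (s j) w)) /\
  (forall i, i \notin codom s -> ~ Q (X i w)).
Proof.
move=> sI; split=> [h|[hU hQ] i].
  split=> [j|i ni]; first by have := h (s j); rewrite slot_codom.
  by have := h i; rewrite slot_notin.
have [/codomP[j ->]|ni] := boolP (i \in codom s).
  by rewrite slot_codom.
by rewrite slot_notin//; exact: hQ.
Qed.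

Lemma measurable_event i (A : set T') :
  measurable A -> measurable (X i @^-1` A).
Proof. by move=> mA; rewrite -[_ @^-1` _]setTI; exact: measurable_funPT. Qed.

Lemma measurable_slot U Q s i : (forall j, measurable (U j)) -> measurable Q ->
  measurable (slot U Q s i).
Proof.
by move=> mU mQ; rewrite /slot; case: pickP => // _; exact: measurableC.
Qed.

Lemma measurable_pattern U Q s : (forall j, measurable (U j)) -> measurable Q ->
  measurable (pattern U Q s).
Proof.
move=> mU mQ; apply: measurable_finite_forall => i.
exact/measurable_event/measurable_slot.
Qed.

Lemma probability_forall (A : 'I_n -> set T') :
  mutually_independent X -> (forall i, measurable (A i)) ->
  P [set w | forall i, A i (X i w)] = (\prod_i P (X i @^-1` A i))%E.
Proof.
move=> Xind mA; have := Xind [set: 'I_n]%SET A mA.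
rewrite (_ : \bigcap_(i in _) _ = [set w | forall i, A i (X i w)]).
  by move=> ->; apply: eq_bigl => i; rewrite finset.inE.
by apply/seteqP; split => w /= h i => [|_]; apply: h; rewrite /= finset.inE.
Qed.

Lemma prod_codom (u r : R) s : injective s ->
  \prod_i (if i \in codom s then u else r) = u ^+ m * r ^+ (n - m).
Proof.
move=> sI; rewrite (bigID (fun i => i \in codom s)) /=; congr (_ * _).
  rewrite (eq_bigr (fun=> u)) => [|i ->//].
  by rewrite prodr_const card_codom// card_ord.
rewrite (eq_bigr (fun=> r)) => [|i /negbTE ->//].
rewrite prodr_const; congr (_ ^+ _).
by rewrite -[in LHS](addKn #|codom s| #|_|) cardC card_codom// !card_ord.
Qed.

Lemma probability_pattern U Q s (u q : R) :
  mutually_independent X -> injective s ->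
  (forall j, measurable (U j)) -> measurable Q ->
  (forall i j, P (X i @^-1` U j) = u%:E) -> (forall i, P (X i @^-1` Q) = q%:E) ->
  P (pattern U Q s) = (u ^+ m * (1 - q) ^+ (n - m))%:E.
Proof.
move=> Xind sI mU mQ PU PQ; rewrite probability_forall//; last first.
  by move=> i; exact: measurable_slot.
rewrite -(prod_codom _ _ sI) -prodEFin; apply: eq_bigr => i _.
case: ifPn => [/codomP[j ->]|ni]; first by rewrite slot_codom.
rewrite slot_notin// -preimage_setC probability_setC ?PQ//.
exact: measurable_event.
Qed.

(** The factor for the [i]-th point is compared with the product of the factors
    for the two patterns.  If both assign [i], it is 0 since the cells are
    disjoint.  If one does, it is [u] instead of [u * (1 - q)], which costs one
    factor [(1 - q)^-1], and this happens at most [2 * m] times.  If none does,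
    it is [1 - 2 * q <= (1 - q) ^+ 2]. *)
Lemma probability_two_patterns U1 Q1 s1 U2 Q2 s2 (u q : R) :
  mutually_independent X -> injective s1 -> injective s2 -> 0 <= u -> q < 1 ->
  (forall j, measurable (U1 j)) -> measurable Q1 ->
  (forall j, measurable (U2 j)) -> measurable Q2 ->
  (forall j, U1 j `<=` Q1) -> (forall j, U2 j `<=` Q2) -> Q1 `&` Q2 = set0 ->
  (forall i j, P (X i @^-1` U1 j) = u%:E) ->
  (forall i j, P (X i @^-1` U2 j) = u%:E) ->
  (forall i, P (X i @^-1` Q1) = q%:E) -> (forall i, P (X i @^-1` Q2) = q%:E) ->
  (P (pattern U1 Q1 s1 `&` pattern U2 Q2 s2) <=
   ((1 - q)^-1 ^+ (2 * m) * (u ^+ m * (1 - q) ^+ (n - m)) ^+ 2)%:E)%E.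
Proof.
move=> Xind s1I s2I u0 q1 mU1 mQ1 mU2 mQ2 UQ1 UQ2 Q12 PU1 PU2 PQ1 PQ2.
have r0 : 0 < 1 - q by rewrite subr_gt0.
(* [c] distributes the loss over the assigned points of each pattern. *)
pose b s (i : 'I_n) : R := if i \in codom s then u else 1 - q.
pose c s (i : 'I_n) : R := if i \in codom s then (1 - q)^-1 else 1.
pose A i := slot U1 Q1 s1 i `&` slot U2 Q2 s2 i.
have mA i : measurable (A i) by apply: measurableI; exact: measurable_slot.
have -> : pattern U1 Q1 s1 `&` pattern U2 Q2 s2 = [set w | forall i, A i (X i w)].
  by apply/seteqP; split => w /= => [[h1 h2] i|h]; [split|split=> i; have [] := h i].
rewrite probability_forall//.
have -> : (1 - q)^-1 ^+ (2 * m) * (u ^+ m * (1 - q) ^+ (n - m)) ^+ 2 =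
    \prod_i (b s1 i * b s2 i * (c s1 i * c s2 i)).
  rewrite !big_split /= !prod_codom// expr1n mul2n -addnn exprD; ring.
rewrite -prodEFin; apply: (@le_trans _ _ (\prod_i (fine (P (X i @^-1` A i)))%:E)%E).
  rewrite le_eqVlt; apply/orP; left; apply/eqP; apply: eq_bigr => i _.
  by rewrite fineK// fin_num_measure//; exact: measurable_event.
rewrite !prodEFin lee_fin; apply: ler_prod => i _.
rewrite fine_ge0//= -lee_fin fineK; last first.
  by rewrite fin_num_measure//; exact: measurable_event.
have q0 : 0 <= q by rewrite -lee_fin -(PQ1 i).
rewrite /b /c /A.
have [/codomP[j ij]|n1] := boolP (i \in codom s1);
  have [/codomP[k ik]|n2] := boolP (i \in codom s2).
- have -> : slot U1 Q1 s1 i = U1 j by rewrite ij slot_codom.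
  have -> : slot U2 Q2 s2 i = U2 k by rewrite ik slot_codom.
  rewrite (_ : _ `&` _ = set0).
    by rewrite preimage_set0 measure0 lee_fin !mulr_ge0// invr_ge0 ltW.
  by apply/seteqP; split=> // x [/UQ1 ? /UQ2 ?]; rewrite -Q12.
- have -> : slot U1 Q1 s1 i = U1 j by rewrite ij slot_codom.
  rewrite slot_notin// mulr1 mulfK ?gt_eqF// -(PU1 i j).
  apply: le_measure; rewrite ?inE; [|exact: measurable_event|by move=> w []].
  exact/measurable_event/measurableI/measurableC.
- have -> : slot U2 Q2 s2 i = U2 k by rewrite ik slot_codom.
  rewrite slot_notin// mul1r mulrAC mulfV ?gt_eqF// mul1r -(PU2 i k).
  apply: le_measure; rewrite ?inE; [|exact: measurable_event|by move=> w []].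
  by apply: measurable_event; apply: measurableI => //; exact: measurableC.
- rewrite !slot_notin// !mulr1 -setCU -preimage_setC probability_setC; last first.
    by apply: measurable_event; exact: measurableU.
  rewrite preimage_setU measureU//; last first.
  - by rewrite -preimage_setI Q12 preimage_set0.
  - exact: measurable_event.
  - exact: measurable_event.
  rewrite [X in (_ - (X + _))%E]PQ1 [X in (_ - (_ + X))%E]PQ2 -EFinD lee_fin.
  nra.
Qed.

(** The second moment method for the patterns indexed by a cell and an injective
    assignment.  Two patterns in the same cell are incompatible: every assigned
    point is in the cell, hence assigned by the other pattern too, and its
    position determines its column. *)
Lemma patterns_occur K (U : 'I_K -> 'I_m -> set T') (Q : 'I_K -> set T')
    (u q : R) :
  (0 < K)%N -> (m <= n)%N -> mutually_independent X -> 0 < u -> q < 1 ->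
  (forall k j, measurable (U k j)) -> (forall k, measurable (Q k)) ->
  (forall k j, U k j `<=` Q k) ->
  (forall k i j x, U k i x -> U k j x -> i = j) ->
  (forall k l x, Q k x -> Q l x -> k = l) ->
  (forall i k j, P (X i @^-1` U k j) = u%:E) ->
  (forall i k, P (X i @^-1` Q k) = q%:E) ->
  ((1 - (((K * n ^_ m)%:R * (u ^+ m * (1 - q) ^+ (n - m)))^-1 +
         ((1 - q)^-1 ^+ (2 * m) - 1)))%:E <=
   P [set w | exists k s, injective s /\ pattern (U k) (Q k) s w])%E.
Proof.
move=> K0 mn Xind u0 q1 mU mQ UQ Uinj Qinj PU PQ.
pose I := {ks : 'I_K * {ffun 'I_m -> 'I_n} | injectiveb ks.2}.
pose A (i : I) := pattern (U (val i).1) (Q (val i).1) (val i).2.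
have inj (i : I) : injective (val i).2 by exact/injectiveP/(valP i).
have cardI : #|{: I}| = (K * n ^_ m)%N.
  rewrite card_sig (eq_card (B := finset.setX [set: 'I_K]%SET
    [set s : {ffun 'I_m -> 'I_n} | injectiveb s]%SET)); last first.
    by move=> ks; rewrite !finset.inE.
  by rewrite cardsX cardsT card_inj_ffuns !card_ord.
have -> : [set w | exists k s, injective s /\ pattern (U k) (Q k) s w] =
    \bigcup_i A i.
  apply/seteqP; split=> [w [k [s [/injectiveP sI ps]]]|w [i _ Ai]].
    by exists (Sub (k, s) sI : I).
  by exists (val i).1, (val i).2; split; [exact: inj|].
have r0 : 0 < 1 - q by rewrite subr_gt0.
rewrite -cardI; apply: second_moment.
- by rewrite cardI muln_gt0 K0 ffact_gt0.
- by rewrite mulr_gt0 ?exprn_gt0.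
- by rewrite exprn_ge0 ?invr_ge0 ?ltW.
- by move=> i; exact: measurable_pattern.
- by move=> i; exact: probability_pattern (inj i) _ _ _ _.
move=> i j ij.
have [kij|kij] := eqVneq (val i).1 (val j).1; last first.
  apply: probability_two_patterns => //; try exact: inj; try exact: ltW.
  by apply/seteqP; split=> // x [/Qinj h /h/eqP]; rewrite (negbTE kij).
have -> : A i `&` A j = set0; last first.
  by rewrite measure0 lee_fin mulr_ge0 ?sqr_ge0// exprn_ge0// invr_ge0 ltW.
apply/seteqP; split=> // w [/(patternP _ _ _ (inj i))[iU iQ]].
rewrite /A -kij => /(patternP _ _ _ (inj j))[jU jQ].
case/eqP: ij; apply/val_inj; rewrite [LHS]surjective_pairing
    [RHS]surjective_pairing -kij; congr (_, _); apply/ffunP => a.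
have [/codomP[b ab]|/jQ] := boolP ((val i).2 a \in codom (val j).2).
  have := jU b; rewrite -ab => /(Uinj _ _ _ _ (iU a)) e.
  by rewrite ab e.
by case; exact: UQ (iU a).
Qed.

End Patterns.

(** * Uniform points in squares *)

Section Uniform.
Variable R : realType.
Implicit Types (a b h s : R) (C : set (R * R)).

Lemma measurable_square a b h : measurable (square a b h).
Proof. by apply: measurableX; exact: measurable_itv. Qed.

Lemma area_square a b h : 0 < h -> area (square a b h) = (h ^+ 2)%:E.
Proof.
move=> h0; rewrite /area product_measure1E; try exact: measurable_itv.
have length c : lebesgue_measure (`[c, c + h[ : set R) = h%:E.
  by rewrite lebesgue_measure_itv /= lte_fin ltrDl h0 -EFinB addrC addKr.
by rewrite expr2 EFinM; congr (_ * _)%E; exact: length.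
Qed.

Lemma interior_square C : interior C !=set0 ->
  exists a b s, 0 < s /\ square a b s `<=` C.
Proof.
move=> [p /nbhs_ballP[e /= e0 peC]]; exists p.1, p.2, e; split=> // x.
move=> /squareP[/andP[x1 x1'] /andP[x2 x2']]; apply: peC; split.
  by rewrite /ball /= ltr_norml; apply/andP; split; lra.
by rewrite /ball /= ltr_norml; apply/andP; split; lra.
Qed.

Variables (d : measure_display) (T : measurableType d) (P : probability T R).
Variables (C : set (R * R)) (X : {RV P >-> (R * R)%type}).
Hypothesis X_uniform : uniform_on C X.

(** Being the normalization of a probability, the area of [C] can be neither zero
    nor infinite: [fine] and the inverse would both send these values to 0. *)
Lemma uniform_area_gt0 : 0 < fine (area C).
Proof.
have := X_uniform measurableT; rewrite setTI /distribution /pushforward.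
rewrite preimage_setT probability_setT.
have : (0 <= area C)%E by exact: measure_ge0.
case: (area C) => [v|//|//] /=.
  rewrite lee_fin le_eqVlt => /predU1P[<-|//].
  by rewrite mul0e => /eqP; rewrite eqe oner_eq0.
by move=> _; rewrite invr0 mule0 => /eqP; rewrite eqe oner_eq0.
Qed.

Lemma uniform_square a b h : 0 < h -> square a b h `<=` C ->
  P (X @^-1` square a b h) = (h ^+ 2 / fine (area C))%:E.
Proof.
move=> h0 hC; have := X_uniform (measurable_square a b h).
rewrite /distribution /pushforward => ->.
by rewrite setIidl// area_square// -EFinM.
Qed.

End Uniform.

(** * Numerical estimates *)

Section Estimates.
Variable R : realType.
Implicit Types (x : R) (n m k : nat).

Lemma bernoulli_sub x n : 0 <= x <= 1 -> 1 - n%:R * x <= (1 - x) ^+ n.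
Proof.
move=> /andP[x0 x1]; elim: n => [|n IHn]; first by rewrite mul0r subr0 expr0.
have : (1 - x) * (1 - n%:R * x) <= (1 - x) ^+ n.+1.
  by rewrite exprS ler_wpM2l// subr_ge0.
apply: le_trans; rewrite -natr1.
have := mulr_ge0 (ler0n R n) (sqr_ge0 x); lra.
Qed.

Lemma ffact_ge n m k : (2 * m <= n)%N -> (k <= m)%N ->
  (n%:R / 2) ^+ k <= (n ^_ k)%:R :> R.
Proof.
move=> mn; elim: k => [|k IHk km]; first by rewrite expr0 ffactn0.
rewrite exprSr ffactnSr natrM ler_pM ?exprn_ge0 ?divr_ge0//.
  by apply: IHk; exact: ltnW.
rewrite ler_pdivrMr// -natrM ler_nat; lia.
Qed.

(** The expected number of patterns stays away from 0: the [n ^_ m] assignments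
    compensate the probability [u ^+ m] with [u] of order [1 / n], and the
    probability that the other points avoid a cell is at least 1/2. *)
Lemma many_patterns n m K : (0 < m)%N -> (0 < K)%N -> (2 * m <= n)%N ->
  K%:R * ((4 * m%:R ^+ 2)^-1 ^+ m / 2) <=
  (K * n ^_ m)%:R * (((2 * n%:R * m%:R ^+ 2)^-1) ^+ m *
                     (1 - (2 * n%:R)^-1) ^+ (n - m)) :> R.
Proof.
move=> m0 K0 mn; have n0 : (0 : R) < n%:R by rewrite ltr0n; lia.
have mR : (0 : R) < m%:R by rewrite ltr0n.
rewrite natrM -mulrA ler_wpM2l// mulrA; apply: ler_pM.
- by rewrite exprn_ge0// invr_ge0 mulr_ge0// sqr_ge0.
- by rewrite invr_ge0.
- have -> : (4 * m%:R ^+ 2)^-1 = n%:R / 2 * (2 * n%:R * m%:R ^+ 2)^-1 :> R.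
    by field; rewrite !gt_eqF.
  rewrite exprMn ler_wpM2r ?exprn_ge0 ?invr_ge0 ?mulr_ge0 ?sqr_ge0 ?ler0n//.
  exact: ffact_ge mn _.
- have q01 : 0 <= (2 * n%:R : R)^-1 <= 1.
    rewrite invr_ge0 mulr_ge0//= invf_le1 ?mulr_gt0//.
    by rewrite -natrM ler1n; lia.
  apply: le_trans (bernoulli_sub (n - m) q01).
  have : (n - m)%:R * (2 * n%:R)^-1 <= n%:R * (2 * n%:R)^-1 :> R.
    by rewrite ler_wpM2r ?(andP q01).1// ler_nat leq_subr.
  have -> : n%:R * (2 * n%:R)^-1 = 2^-1 :> R by field; rewrite gt_eqF.
  lra.
Qed.

Lemma weak_dependence n m : (0 < m)%N -> (2 * m <= n)%N ->
  (1 - (2 * n%:R)^-1)^-1 ^+ (2 * m) - 1 <= 2 * m%:R / n%:R :> R.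
Proof.
move=> m0 mn; have n0 : (0 : R) < n%:R by rewrite ltr0n; lia.
have q01 : 0 <= (2 * n%:R : R)^-1 <= 1.
  rewrite invr_ge0 mulr_ge0//= invf_le1 ?mulr_gt0//.
  by rewrite -natrM ler1n; lia.
have := bernoulli_sub (2 * m) q01.
set y := (1 - _) ^+ _; rewrite exprVn -/y.
have -> : (2 * m)%:R * (2 * n%:R)^-1 = m%:R / n%:R :> R.
  by rewrite natrM; field; rewrite gt_eqF.
rewrite -mulrA; set x := m%:R / n%:R => xy.
have x12 : x <= 1 / 2.
  by rewrite /x ler_pdivrMr// mulrAC ler_pdivlMr// mul1r mulrC -natrM ler_nat.
have x0 : 0 <= x by rewrite divr_ge0.
have y0 : 0 < y by lra.
rewrite lerBlDr -(ler_pM2r y0) mulVf ?gt_eqF//; nra.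
Qed.

End Estimates.

(** * Large degree with high probability *)

Section ManyEmptyTriangles.
Variables (R : realType) (C : set (R * R)) (d : measure_display).
Variables (T : measurableType d) (P : probability T R) (n : nat).
Variable X : 'I_n -> {RV P >-> (R * R)%type}.
Hypothesis X_uniform : forall i, uniform_on C (X i).
Hypothesis X_indep : mutually_independent X.

(** The cells are the squares of side [l.+2%:R * h] placed side by side along the
    bottom of the given square. *)
Lemma degree_probability (a b h L : R) (l K : nat) :
  0 < h -> 0 < L -> L <= l%:R -> (0 < K)%N -> (l.+2 <= n)%N ->
  square a b (K%:R * (l.+2%:R * h)) `<=` C ->
  let u := h ^+ 2 / fine (area C) in
  let q := (l.+2%:R * h) ^+ 2 / fine (area C) in
  q < 1 ->
  ((1 - (((K * n ^_ l.+2)%:R * (u ^+ l.+2 * (1 - q) ^+ (n - l.+2)))^-1 +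
         ((1 - q)^-1 ^+ (2 * l.+2) - 1)))%:E <=
   P [set w | (L <= (degree (point_set X w))%:R)%R])%E.
Proof.
move=> h0 L0 Ll K0 ln hC u q q1.
have n0 : (0 < n)%N by exact: leq_trans ln.
have V0 : 0 < fine (area C) := uniform_area_gt0 (X_uniform (Ordinal n0)).
have H0 : 0 < l.+2%:R * h by rewrite mulr_gt0.
pose H := l.+2%:R * h.
pose Q (k : 'I_K) := square (a + k%:R * H) b H.
pose U (k : 'I_K) (j : 'I_l.+2) := stair_square (a + k%:R * H) b h l.+2 j.
have UQ k j : U k j `<=` Q k by exact: stair_square_sub (ltW h0) (ltn_ord j).
have QC k : Q k `<=` C.
  move=> x /squareP[/andP[x1 x1'] /andP[x2 x2']]; apply: hC; apply/squareP.
  have := next_column (ltW H0) (ltn_ord k).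
  have kH : 0 <= k%:R * H by rewrite mulr_ge0// ltW.
  rewrite -/H in H0 *.
  by move=> ?; split; apply/andP; split; lra.
have PQ i k : P (X i @^-1` Q k) = q%:E.
  exact: (uniform_square (X_uniform i) H0 (QC k)).
have PU i k j : P (X i @^-1` U k j) = u%:E.
  exact: (uniform_square (X_uniform i) h0 (subset_trans (UQ k j) (QC k))).
have Qinj k k' x : Q k x -> Q k' x -> k = k'.
  move=> /squareP[/andP[k1 k1'] _] /squareP[/andP[k2 k2'] _].
  by apply/val_inj; case: (ltngtP k k') => // /(next_column (ltW H0));
    rewrite -/H => ?; exfalso; lra.
apply: le_trans (patterns_occur K0 ln X_indep _ q1 _ _ UQ _ Qinj PU PQ) _.
- by rewrite divr_gt0 ?exprn_gt0.
- by move=> k j; exact: measurable_square.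
- by move=> k; exact: measurable_square.
- move=> k i j x Ui Uj; apply/val_inj.
  exact: stair_square_disjoint (ltW h0) Ui Uj.
apply: le_measure; rewrite ?inE.
- apply: measurable_finite_exists => k; apply: measurable_finite_exists => s.
  apply: measurableI; first exact: measurable_const.
  by apply: measurable_pattern => *; exact: measurable_square.
- exact: measurable_degree_ge.
move=> w [k [s [sI /(patternP _ _ _ _ sI)[sU sQ]]]] /=.
apply: le_trans Ll _.
exact: (degree_staircase (ltW h0) sU sQ).
Qed.

(** The cells have area [fine (area C) / (2 * n)], so that each receives half a
    sample point on average.  The bound on [K] makes their row fit in the square
    of side [s]. *)
Lemma degree_probability_scaled (a b s L : R) (l K : nat) :
  0 < s -> 0 < L -> L <= l%:R -> (0 < K)%N -> (2 * l.+2 <= n)%N ->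
  square a b s `<=` C ->
  K%:R ^+ 2 * fine (area C) <= 2 * n%:R * s ^+ 2 ->
  ((1 - ((K%:R * ((4 * l.+2%:R ^+ 2)^-1 ^+ l.+2 / 2))^-1 +
         2 * l.+2%:R / n%:R))%:E <=
   P [set w | (L <= (degree (point_set X w))%:R)%R])%E.
Proof.
move=> s0 L0 Ll K0 ln sC Ks.
have n0 : (0 < n)%N by lia.
have nR : (0 : R) < n%:R by rewrite ltr0n.
have V0 : 0 < fine (area C) := uniform_area_gt0 (X_uniform (Ordinal n0)).
set V := fine (area C) in V0 Ks.
pose H := Num.sqrt (V / (2 * n%:R)).
have H2 : H ^+ 2 = V / (2 * n%:R) by rewrite sqr_sqrtr// divr_ge0 ?mulr_ge0// ltW.
have H0 : 0 < H by rewrite sqrtr_gt0 divr_gt0 ?mulr_gt0.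
pose h := H / l.+2%:R; have h0 : 0 < h by rewrite divr_gt0.
have mh : l.+2%:R * h = H by rewrite /h mulrC divfK.
have uE : h ^+ 2 / V = (2 * n%:R * l.+2%:R ^+ 2)^-1.
  rewrite /h expr_div_n H2; field.
  by rewrite !gt_eqF ?ltr0n.
have qE : (l.+2%:R * h) ^+ 2 / V = (2 * n%:R)^-1.
  by rewrite mh H2; field; rewrite !gt_eqF.
have q1 : (2 * n%:R)^-1 < 1 :> R.
  by rewrite invf_lt1 ?mulr_gt0// -natrM ltr1n; lia.
have KH : K%:R * H <= s.
  rewrite -(@ler_pXn2r _ 2) ?nnegrE ?mulr_ge0 ?(ltW s0) ?(ltW H0)//.
  by rewrite exprMn H2 mulrA ler_pdivrMr ?mulr_gt0// (mulrC (s ^+ 2)).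
have sub : square a b (K%:R * (l.+2%:R * h)) `<=` C.
  rewrite mh; apply: subset_trans sC => x /squareP[/andP[? ?] /andP[? ?]].
  by apply/squareP; split; apply/andP; split => //; lra.
have ln' : (l.+2 <= n)%N by apply: leq_trans ln; rewrite leq_pmull.
have := degree_probability h0 L0 Ll K0 ln' sub; rewrite /= -/V uE qE.
move=> /(_ q1); apply: le_trans.
rewrite lee_fin lerB// lerD//; last exact: weak_dependence.
set c := K%:R * _.
have c0 : 0 < c.
  by rewrite mulr_gt0 ?ltr0n ?divr_gt0 ?exprn_gt0 ?invr_gt0 ?mulr_gt0 ?exprn_gt0.
have le_c := many_patterns R (ltn0Sn l.+1) K0 ln.
by rewrite lef_pV2 ?posrE// (lt_le_trans c0 le_c).
Qed.

End ManyEmptyTriangles.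

Theorem theorem2 (R : realType) (C : set (R * R))
    (C_compact : compact C)
    (C_convex : @convex_set R (R^o * R^o)%type C)
    (C_interior : interior C !=set0)
    (d : nat -> measure_display)
    (T : forall n : nat, measurableType (d n))
    (P : forall n : nat, probability (T n) R)
    (X : forall n : nat, 'I_n -> {RV (P n) >-> (R * R)%type})
    (X_uniform : forall (n : nat) (i : 'I_n), uniform_on C (X n i))
    (X_indep : forall n : nat, mutually_independent (X n))
    (L : R) (L_gt0 : 0 < L) :
  (fun n : nat => P n [set w | L <= (degree (point_set (X n) w))%:R])
    @ \oo --> (1%:E : \bar R).
Proof.
have [a [b [s [s0 sC]]]] := interior_square C_interior.
have [l Ll] : exists l : nat, L <= l%:R.
  by exists (Num.bound L); rewrite ltW// archi_boundP// ltW.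
have mE n := measurable_degree_ge (X n) L_gt0.
apply: cvg_EFin.
  by apply: nearW => n; rewrite fin_num_measure.
apply/cvgrPdist_le => eps eps0.
pose c : R := (4 * l.+2%:R ^+ 2)^-1 ^+ l.+2 / 2.
have c0 : 0 < c by rewrite divr_gt0 ?exprn_gt0 ?invr_gt0 ?mulr_gt0 ?exprn_gt0.
have [K K0 Kc] : exists2 K, (0 < K)%N & (K%:R * c)^-1 <= eps / 2.
  have ec0 : 0 < 2 / (eps * c) by rewrite divr_gt0 ?(mulr_gt0 eps0 c0).
  have K_large := archi_boundP (ltW ec0).
  set K := Num.bound _ in K_large.
  have K0 : (0 : R) < K%:R by exact: lt_trans K_large.
  exists K; first by rewrite -(ltr0n R).
  have e2 : 0 < (eps / 2)^-1 by rewrite invr_gt0 divr_gt0.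
  rewrite -[leRHS]invrK lef_pV2 ?posrE ?(mulr_gt0 K0 c0)//.
  rewrite invf_div; apply: ltW; move: K_large.
  by rewrite -ltr_pdivrMr// invfM mulrA.
near=> n.
have n_large : (2 * l.+2 <= n)%N by near: n; exact: nbhs_infty_ge.
have n_gt0 : (0 : R) < n%:R by rewrite ltr0n; apply: leq_trans n_large.
have n_fit : K%:R ^+ 2 * fine (area C) <= 2 * n%:R * s ^+ 2.
  have : K%:R ^+ 2 * fine (area C) / (2 * s ^+ 2) <= n%:R.
    by near: n; exact: nbhs_infty_ger.
  rewrite ler_pdivrMr; first by rewrite mulrCA mulrA.
  by apply: mulr_gt0 => //; exact: exprn_gt0.
have n_eps : 2 * l.+2%:R / n%:R <= eps / 2.
  have : 2 * l.+2%:R / (eps / 2) <= n%:R.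
    by near: n; exact: nbhs_infty_ger.
  by rewrite !ler_pdivrMr ?divr_gt0// (mulrC n%:R).
have := degree_probability_scaled (X_uniform n) (X_indep n) s0 L_gt0 Ll
  K0 n_large sC n_fit.
rewrite -/c -[P n _]fineK ?fin_num_measure// lee_fin => lower.
have upper : fine (P n [set w | L <= (degree (point_set (X n) w))%:R]) <= 1.
  by rewrite -lee_fin fineK ?fin_num_measure// probability_le1.
rewrite [leLHS]/= ger0_norm ?subr_ge0//; lra.
Unshelve. all: by end_near.
Qed.
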